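(* Let $n\ge1$ and $1\le k\le 2n$ be integers, let $U=\{u_1,\dots,u_n\}$, $V=\{v_1,\dots,v_n\}$ be the parts of $K_{n,n}$, and let $X^{u}_{n,k}\subseteq\mathbb{R}^{n^2}$ be the set of all vectors $x$ with $x_{i,j}=1$ if $u_i\in A$ and $v_j\in B$, $x_{i,j}=0$ otherwise, where $A\subseteq U$, $B\subseteq V$ range over all pairs with $|A|+|B|=k$. For $x\in X^u_{n,k}$ let $$K^{\max}_{n,k}(x)=\{c\in\mathbb{R}^{n^2}_{+}:\ \langle c,x\rangle\ge\langle c,y\rangle\ \text{for all } y\in X^u_{n,k}\},$$ and let the graph of the cone decomposition $K^{\max}_{n,k}$ have these cones as vertices, two cones $K^{\max}_{n,k}(x)$, $K^{\max}_{n,k}(y)$ ($x\ne y$) being adjacent iff $\dim\big(K^{\max}_{n,k}(x)\cap K^{\max}_{n,k}(y)\big)=n^2-1$. Then the clique number $\omega(K^{\max}_{n,k})$ of this graph satisfies $$\omega(K^{\max}_{n,k})\ge\binom{n}{s}=\Omega\!\left(\left(\frac{n}{s}\right)^{s}\right)\ \text{ if } k=2s,\qquad \omega(K^{\max}_{n,k})\ge\binom{n-1}{s}=\Omega\!\left(\left(\frac{n-1}{s}\right)^{s}\right)\ \text{ if } k=2s+1.$$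
   Context: $\mathbb{R}^{d}_{+}$ denotes the nonnegative orthant. The clique number of a graph is the maximum size of a set of pairwise adjacent vertices. *)

(* Defs.v *)
From mathcomp Require Import all_boot all_order all_algebra.
From mathcomp Require Import finmap.
From mathcomp Require Import boolp classical_sets functions cardinality reals.

Set Implicit Arguments.
Unset Strict Implicit.
Unset Printing Implicit Defensive.

Import Order.TTheory GRing.Theory Num.Theory.

Local Open Scope classical_set_scope.
Local Open Scope ring_scope.

Section Dimension.
Variables (F : fieldType) (vT : vectType F).
Implicit Types (S : set vT) (W : {vspace vT}).

Definition is_linear_hull S W :=
  S `<=` [set x | x \in W] /\
  forall W' : {vspace vT}, S `<=` [set x | x \in W'] -> (W <= W')%VS.

Definition linear_hull S : {vspace vT} := xget 0%VS [set W | is_linear_hull S W].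

Lemma linear_hullP S : is_linear_hull S (linear_hull S).
Proof.
rewrite /linear_hull; apply: (@xgetPex _ _ [set W | is_linear_hull S W]).
pose P d := `[< exists W, S `<=` [set x | x \in W] /\ \dim W = d >].
have exP : exists d, P d.
  exists (\dim {: vT}); apply/asboolP; exists fullv.
  by split=> // x _; rewrite /= memvf.
case: (ex_minnP exP) => d /asboolP[W [SW dW]] dmin.
exists W; split=> // W' SW'.
have : P (\dim (W :&: W')%VS).
  apply/asboolP; exists (W :&: W')%VS; split=> // x Sx /=.
  by rewrite memv_cap; apply/andP; split; [exact: SW | exact: SW'].
move/dmin; rewrite -dW => leWd.
have /eqP <- : (W :&: W' == W)%VS by rewrite eqEdim capvSl.
exact: capvSr.
Qed.

(* The dimension of the affine hull of S: the linear hull of the differences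
   is the direction space of that affine hull. *)
Definition affine_dim S : nat :=
  \dim (linear_hull [set d | exists x y, [/\ S x, S y & d = x - y]]).

End Dimension.

Section CliqueNumber.
Variables (T : choiceType) (V : set T) (adj : T -> T -> Prop).

Definition is_clique (Q : {fset T}) :=
  forall a b, a \in Q -> b \in Q -> a != b -> adj a b.

(* Meaningful for a finite vertex set V; fset_set V is empty otherwise. *)
Definition clique_number : nat :=
  (\max_(Q <- fpowerset (fset_set V) | `[< is_clique Q >]) #|` Q|)%N.

End CliqueNumber.

Section Bicliques.
Variables (R : realType) (n k : nat).
Implicit Types (x y c : 'M[R]_n) (C D : set 'M[R]_n).

(* The space R^(n^2), with coordinates indexed by pairs (i, j), is 'M[R]_n. *)

Definition biclique_vec (A B : {set 'I_n}) : 'M[R]_n :=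
  \matrix_(i, j) (if (i \in A) && (j \in B) then 1 else 0).

Definition Xu : set 'M[R]_n :=
  [set x | exists A B : {set 'I_n}, (#|A| + #|B| = k)%N /\ x = biclique_vec A B].

Definition inner c x : R := \sum_i \sum_j c i j * x i j.

Definition Kmax x : set 'M[R]_n :=
  [set c : 'M[R]_n | (forall i j, 0 <= c i j) /\ forall y, Xu y -> inner c y <= inner c x].

Definition Kmax_cones : set (set 'M[R]_n) := [set Kmax x | x in Xu].

Definition Kmax_adj C D : Prop :=
  exists x y, [/\ Xu x, Xu y, x <> y, C = Kmax x & D = Kmax y] /\
    affine_dim (Kmax x `&` Kmax y) = (n ^ 2 - 1)%N.

Lemma finite_Kmax_cones : finite_set Kmax_cones.
Proof.
apply: finite_image.
apply: (@sub_finite_set _ _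
  [set biclique_vec p.1 p.2 | p in [set: {set 'I_n} * {set 'I_n}]]).
  by move=> x [A [B [_ ->]]]; exists (A, B).
by apply: finite_image; exact: finite_finset.
Qed.

Definition omega_Kmax : nat := clique_number Kmax_cones Kmax_adj.

End Bicliques.

(* Main.v *)
(* If c has entries bounded away from 0 and is maximized over X^u exactly at two
   points x, y, then every c + t d with d orthogonal to x - y and t small lies in
   both cones, so these meet in dimension n^2 - 1; moving c along x - y instead
   shows that the two cones differ. For k = 2s the bicliques (S, S) with |S| = s
   are pairwise adjacent: take c large on the union of S x S and T x T. An optimal
   A x B has |A| = |B| = s and lies in that union, hence is S x S or T x T. For
   k = 2s + 1 use (S + v, S) with S avoiding a fixed vertex v; now
   ((S & T) + v) x (S | T) may also be optimal, and slightly decreasing c on row v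
   excludes it. *)

Require Import Defs.
From HB Require Import structures.
From mathcomp Require Import finmap boolp classical_sets cardinality.
From mathcomp Require Import all_boot all_order all_algebra.
From mathcomp Require Import reals.
From mathcomp Require Import zify ring lra.

Set Implicit Arguments.
Unset Strict Implicit.
Unset Printing Implicit Defensive.

Import Order.TTheory GRing.Theory Num.Theory.
Local Open Scope ring_scope.

(** * The inner product and its orthogonal hyperplanes *)

Section Inner.
Variables (R : realType) (n : nat).
Implicit Types (c d x y : 'M[R]_n) (A B : {set 'I_n}).

Lemma innerDl c d x : inner (c + d) x = inner c x + inner d x.
Proof.
rewrite /inner -big_split; apply: eq_bigr => i _ /=.
by rewrite -big_split; apply: eq_bigr => j _ /=; rewrite !mxE mulrDl.
Qed.

Lemma innerZl a c x : inner (a *: c) x = a * inner c x.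
Proof.
rewrite /inner mulr_sumr; apply: eq_bigr => i _.
by rewrite mulr_sumr; apply: eq_bigr => j _; rewrite !mxE mulrA.
Qed.

Lemma innerC c x : inner c x = inner x c.
Proof. by apply: eq_bigr => i _; apply: eq_bigr => j _; rewrite mulrC. Qed.

Lemma innerBr c x y : inner c (x - y) = inner c x - inner c y.
Proof. by rewrite innerC -scaleN1r innerDl innerZl mulN1r ![inner _ c]innerC. Qed.

Lemma inner_gt0 x : x <> 0 -> 0 < inner x x.
Proof.
have sq_ge0 i j : 0 <= x i j * x i j by rewrite -expr2 sqr_ge0.
have row_ge0 i : 0 <= \sum_j x i j * x i j by apply: sumr_ge0 => j _.
move=> x0; rewrite lt_def sumr_ge0 ?andbT //.
apply/eqP => xx0; apply: x0; apply/matrixP => i j; rewrite mxE.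
have row0 := psumr_eq0P (fun i _ => row_ge0 i) xx0 (i := i) isT.
have /eqP := psumr_eq0P (fun j _ => sq_ge0 i j) row0 (i := j) isT.
by rewrite mulf_eq0 orbb => /eqP.
Qed.

Definition inner_form x c : R^o := inner c x.

Lemma inner_form_is_linear x : linear (inner_form x).
Proof. by move=> a c d; rewrite /inner_form innerDl innerZl. Qed.

HB.instance Definition _ x :=
  GRing.isLinear.Build R 'M[R]_n R^o _ (inner_form x) (inner_form_is_linear x).

Definition orthogonal_space x : {vspace 'M[R]_n} := lker (linfun (inner_form x)).

Lemma mem_orthogonal_space x c : (c \in orthogonal_space x) = (inner c x == 0).
Proof. by rewrite memv_ker lfunE. Qed.

(** Rank-nullity: the form is nonzero at [x] itself, so its image is a line. *)
Lemma dim_orthogonal_space x : x <> 0 -> \dim (orthogonal_space x) = (n ^ 2 - 1)%N.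
Proof.
move=> x0; have := limg_ker_dim (linfun (inner_form x)) fullv.
rewrite capfv dimvf dim_matrix.
suff -> : \dim (limg (linfun (inner_form x))) = 1%N.
  by move=> h; rewrite -mulnn -[(n * n)%N]h addnK.
apply/eqP; rewrite eqn_leq; apply/andP; split.
  by have := dimvS (subvf (limg (linfun (inner_form x)))); rewrite dimvf.
rewrite lt0n dimv_eq0; apply/eqP => img0.
have := memv_img (linfun (inner_form x)) (memvf x).
rewrite img0 memv0 lfunE /= /inner_form => /eqP xx0.
by have := inner_gt0 x0; rewrite xx0 ltxx.
Qed.

Lemma inner_biclique c A B :
  inner c (biclique_vec R A B) = \sum_(p in finset.setX A B) c p.1 p.2.
Proof.
rewrite /inner pair_bigA /= [RHS]big_mkcond /=; apply: eq_bigr => p _.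
by rewrite mxE inE; case: ifP => _; rewrite ?mulr1 ?mulr0.
Qed.

(** The bound is uniform in [A] and [B], so one step size serves all of [Xu]. *)
Lemma norm_inner_biclique c A B :
  `|inner c (biclique_vec R A B)| <= \sum_i \sum_j `|c i j|.
Proof.
apply: le_trans (ler_norm_sum _ _ _) _; apply: ler_sum => i _.
apply: le_trans (ler_norm_sum _ _ _) _; apply: ler_sum => j _.
by rewrite mxE normrM; case: ifP => _; rewrite ?normr1 ?mulr1 // normr0 mulr0.
Qed.

End Inner.

(** * From a separating cost to adjacent cones *)

Section Separation.
Variables (R : realType) (n k : nat).
Implicit Types (c d x y z : 'M[R]_n) (A B : {set 'I_n}).

(** Both constants 1 are a normalization that integer costs meet; they leave slack to perturb [c] in
    every direction. *)
Definition separates c x y :=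
  [/\ forall i j, 1 <= c i j, inner c x = inner c y &
      forall z, Xu k z -> z <> x -> z <> y -> inner c z + 1 <= inner c x].

Lemma separates_sym c x y : separates c x y -> separates c y x.
Proof. by case=> c1 cxy cz; split=> // z Xz zy zx; rewrite -cxy; exact: cz. Qed.

(** The step moves each entry and each value on [Xu] by at most 1/2, so entries stay nonnegative and
    the gap of 1 survives; only the comparison of [x] with [y] is left to [d]. *)
Lemma separates_perturb c x y d : Xu k x -> Xu k y -> separates c x y ->
  exists2 t, 0 < t &
    (inner d y <= inner d x -> Kmax k x (c + t *: d)) /\
    (inner d x <= inner d y -> Kmax k y (c + t *: d)).
Proof.
pose m := \sum_i \sum_j `|d i j|.
have m_ge0 : 0 <= m by apply: sumr_ge0 => i _; exact: sumr_ge0.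
(* The summand 1 keeps the denominator positive when [d = 0]. *)
pose t := (1 + 2 * m)^-1.
have t_gt0 : 0 < t by rewrite invr_gt0; lra.
have tm : t * m <= 1 / 2.
  by rewrite /t mulrC ler_pdivrMr; lra.
have d_entry i j : `|d i j| <= m.
  rewrite /m (bigD1 i) //= (bigD1 j) //= -addrA lerDl addr_ge0 ?sumr_ge0 // => i' _.
  exact: sumr_ge0.
have d_inner z : Xu k z -> `|t * inner d z| <= 1 / 2.
  move=> [A [B [_ ->]]]; apply: le_trans tm.
  by rewrite normrM gtr0_norm // ler_pM2l // norm_inner_biclique.
suff main x' y' : Xu k x' -> Xu k y' -> separates c x' y' ->
    inner d y' <= inner d x' -> Kmax k x' (c + t *: d).
  move=> Xx Xy sep; exists t => //; split; first exact: main.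
  by apply: main => //; exact: separates_sym.
move=> Xx Xy [c1 cxy cz] dyx; split=> [i j|z Xz].
  rewrite !mxE; have := c1 i j; have := d_entry i j; rewrite ler_norml => /andP[dm _].
  have : t * - m <= t * d i j by rewrite ler_pM2l.
  lra.
rewrite !innerDl !innerZl.
have [->//|zx] := EM (z = x').
have [->|zy] := EM (z = y'); first by rewrite cxy lerD2l ler_pM2l.
have := cz _ Xz zx zy; have := d_inner _ Xz; have := d_inner _ Xx.
rewrite !ler_norml => /andP[? ?] /andP[? ?]; lra.
Qed.

(** Graph vertices are cones, so counting bicliques requires their cones to be distinct. *)
Lemma separates_Kmax_neq c x y : Xu k x -> Xu k y -> x <> y -> separates c x y ->
  Kmax k x <> Kmax k y.
Proof.
move=> Xx Xy xy sep Kxy.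
have xy0 : x - y <> 0 by move/eqP; rewrite subr_eq0 => /eqP.
have := inner_gt0 xy0; rewrite innerBr subr_gt0 => lt_yx.
have [t t_gt0 [Kx _]] := separates_perturb (x - y) Xx Xy sep.
have := Kx (ltW lt_yx); rewrite Kxy => -[_ /(_ _ Xx)].
case: sep => _ cxy _.
by rewrite !innerDl !innerZl cxy lerD2l ler_pM2l // leNgt lt_yx.
Qed.

Lemma separates_dim c x y : Xu k x -> Xu k y -> x <> y -> separates c x y ->
  affine_dim (classical_sets.setI (Kmax k x) (Kmax k y)) = (n ^ 2 - 1)%N.
Proof.
move=> Xx Xy xy sep.
have xy0 : x - y <> 0 by move/eqP; rewrite subr_eq0 => /eqP.
rewrite -(dim_orthogonal_space xy0) /affine_dim; set S := (X in linear_hull X).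
have [hullS hull_min] := linear_hullP S.
(* Costs in both cones take equal values at [x] and [y], hence so do their differences; the converse
   inclusion perturbs [c]. *)
congr (\dim _); apply: subv_anti; apply/andP; split.
  apply: hull_min => _ [a [b [[[_ ax] [_ ay]] [[_ bx] [_ b_y]] ->]]] /=.
  rewrite mem_orthogonal_space innerBr.
  rewrite [inner _ x]innerC [inner _ y]innerC !innerBr.
  rewrite ![inner x _]innerC ![inner y _]innerC.
  have := ax _ Xy; have := ay _ Xx; have := bx _ Xy; have := b_y _ Xx.
  move=> ? ? ? ?; apply/eqP; lra.
apply/subvP => d; rewrite mem_orthogonal_space innerBr subr_eq0 => /eqP dxy.
have [t t_gt0 [Kx Ky]] := separates_perturb d Xx Xy sep.
(* Perturbing by 0 puts [c] itself in both cones, so [t *: d] is a difference of two of their common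
   points. *)
have [t0 t0_gt0 [Kx0 Ky0]] := separates_perturb 0 Xx Xy sep.
have inner0 z : inner 0 z = 0 :> R by rewrite -(scale0r 0) innerZl mul0r.
have : S (t *: d).
  exists (c + t *: d), (c + t0 *: 0); split.
  - by split; [apply: Kx | apply: Ky]; rewrite dxy.
  - by split; [apply: Kx0 | apply: Ky0]; rewrite !inner0.
  - by rewrite scaler0 addr0 [c + _]addrC addrK.
move/hullS => /= tdS; rewrite -[d]scale1r -(mulVf (lt0r_neq0 t_gt0)) -scalerA.
exact: memvZ.
Qed.

Lemma leq_card_omega_Kmax (T : finType) (P : {set T}) (F : T -> 'M[R]_n) :
    {in P, forall S, Xu k (F S)} -> {in P &, injective F} ->
    {in P &, forall S1 S2, S1 != S2 -> exists c, separates c (F S1) (F S2)} ->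
  (#|P| <= omega_Kmax R n k)%N.
Proof.
move=> XF injF sepF.
have neqF S1 S2 : S1 \in P -> S2 \in P -> S1 != S2 -> F S1 <> F S2.
  by move=> P1 P2 /eqP S12 /(injF _ _ P1 P2).
pose Q : {fset set 'M[R]_n} := [fset Kmax k (F S) | S in P]%fset.
have cardQ : #|` Q| = #|P|.
  rewrite card_in_imfset -?cardE //= => S1 S2 P1 P2 K12; apply/eqP/negPn/negP => S12.
  have [c sep] := sepF _ _ P1 P2 S12.
  exact: separates_Kmax_neq (XF _ P1) (XF _ P2) (neqF _ _ P1 P2 S12) sep K12.
rewrite -cardQ; apply: (@leq_bigmax_seq _ _ _ (fun Q : {fset set 'M[R]_n} => #|` Q|)).
  rewrite fpowersetE; apply/fsubsetP => _ /imfsetP[S /= PS ->].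
  (* Finiteness matters here: [fset_set] of an infinite set is empty. *)
  rewrite (in_fset_set (finite_Kmax_cones R n k)); apply: mem_set.
  by exists (F S) => //; exact: XF.
apply/asboolP => _ _ /imfsetP[S1 /= P1 ->] /imfsetP[S2 /= P2 ->] K12.
have S12 : S1 != S2 by apply: contraNneq K12 => ->.
have [c sep] := sepF _ _ P1 P2 S12.
exists (F S1), (F S2); split; first by split => //; [exact: XF|exact: XF|exact: neqF].
by apply: separates_dim sep; [exact: XF|exact: XF|exact: neqF].
Qed.

End Separation.

(** * Integer costs with exactly two optimal bicliques *)

Section Combinatorics.
Variables (R : realType) (n : nat).
Implicit Types (A B S T : {set 'I_n}) (X U G : {set 'I_n * 'I_n}).
Local Notation setX := finset.setX.

(** A point of [A] outside [A1] forces [B] into [B2], and one outside [A2] forces [B] into [B1]; the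
    four cases tell which such points exist. *)
Lemma subset_rectangles A A1 A2 B B1 B2 :
    (0 < #|A|)%N -> (0 < #|B|)%N ->
    setX A B \subset setX A1 B1 :|: setX A2 B2 ->
  [\/ A \subset A1 /\ B \subset B1, A \subset A2 /\ B \subset B2,
      A \subset A1 :&: A2 /\ B \subset B1 :|: B2
    | A \subset A1 :|: A2 /\ B \subset B1 :&: B2].
Proof.
move=> /card_gt0P[a0 Aa0] /card_gt0P[b0 Bb0] /subsetP sub.
have cover a b : a \in A -> b \in B ->
    (a \in A1) && (b \in B1) || (a \in A2) && (b \in B2).
  by move=> Aa Bb; have := sub (a, b); rewrite !inE /= Aa Bb => /(_ isT).
have [sA1|/subsetPn[a1 Aa1 a1N]] := boolP (A \subset A1);
have [sA2|/subsetPn[a2 Aa2 a2N]] := boolP (A \subset A2).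
- apply: Or43; split; first by rewrite subsetI sA1.
  apply/subsetP => b Bb; rewrite inE; move: (cover _ _ Aa0 Bb).
  by case/orP => /andP[_ ->] //; rewrite orbT.
- apply: Or41; split=> //; apply/subsetP => b Bb.
  by move: (cover _ _ Aa2 Bb); rewrite (negPf a2N) /= orbF => /andP[].
- apply: Or42; split=> //; apply/subsetP => b Bb.
  by move: (cover _ _ Aa1 Bb); rewrite (negPf a1N) /= => /andP[].
- apply: Or44; split; apply/subsetP => e He; rewrite inE.
    by move: (cover _ _ He Bb0); case/orP => /andP[-> _] //; rewrite orbT.
  move: (cover _ _ Aa1 He) (cover _ _ Aa2 He).
  by rewrite (negPf a1N) (negPf a2N) /= orbF => /andP[_ ->] /andP[_ ->].
Qed.

(** Each cell has base weight, doubled inside [U], so the main score reaches [p + p] exactly on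
    rectangles of size [p] inside [U]. Among these [G] decides, and integrality gives the gap of
    1. *)
Lemma separates_biclique k U G (p q : nat) A1 B1 A2 B2 :
    setX A1 B1 \subset U -> setX A2 B2 \subset U ->
    #|setX A1 B1| = p -> #|setX A2 B2| = p ->
    #|setX A1 B1 :&: G| = q -> #|setX A2 B2 :&: G| = q ->
    (forall A B, (#|A| + #|B| = k)%N -> (#|A| * #|B| <= p)%N) ->
    (forall A B, (#|A| + #|B| = k)%N -> (#|A| * #|B| = p)%N ->
       setX A B \subset U ->
       [\/ A = A1 /\ B = B1, A = A2 /\ B = B2 | (#|setX A B :&: G| < q)%N]) ->
  exists c, separates k c (biclique_vec R A1 B1) (biclique_vec R A2 B2).
Proof.
move=> sU1 sU2 card1 card2 cardG1 cardG2 le_p opt.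
(* N exceeds every #|setX A B :&: G|, so G only breaks ties. *)
pose N := (n * n).+1.
pose w (e : 'I_n * 'I_n) : nat := (N * (1 + (e \in U)) + (e \in G))%N.
have weightE X : (\sum_(e in X) w e = N * (#|X| + #|X :&: U|) + #|X :&: G|)%N.
  have cardI (Y : {set _}) : (\sum_(e in X) (e \in Y) = #|X :&: Y|)%N.
    rewrite -sum1_card big_mkcond [RHS]big_mkcond; apply: eq_bigr => e _.
    by rewrite inE; do 2!case: (_ \in _).
  by rewrite big_split -big_distrr big_split /= sum1_card !cardI.
pose c : 'M[R]_n := \matrix_(i, j) (w (i, j))%:R.
have innerE A B : inner c (biclique_vec R A B) =
    (N * (#|setX A B| + #|setX A B :&: U|) + #|setX A B :&: G|)%:R.
  rewrite inner_biclique -weightE natr_sum; apply: eq_bigr => -[i j] _.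
  by rewrite mxE.
have val A B : setX A B \subset U -> #|setX A B| = p -> #|setX A B :&: G| = q ->
    inner c (biclique_vec R A B) = (N * (p + p) + q)%:R.
  by move=> sU cX cG; rewrite innerE cG (setIidPl sU) cX.
exists c; split.
- by move=> i j; rewrite mxE ler1n /w /N; lia.
- by rewrite !val.
move=> _ [A [B [kAB ->]]] neq1 neq2; rewrite (val A1 B1) // innerE natr1 ler_nat.
have := le_p _ _ kAB; rewrite -cardsX => leXp.
have leXU := subset_leq_card (subsetIl (setX A B) U).
have leXG : (#|setX A B :&: G| <= n * n)%N.
  have := max_card [in setX A B :&: G].
  by rewrite card_prod card_ord.
have [full|] := boolP ((#|setX A B| == p) && (setX A B \subset U)).
  have /andP[/eqP cX sU] := full.
  have [] := opt A B kAB; rewrite -?cardsX //.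
  - by case=> eA eB; rewrite eA eB in neq1.
  - by case=> eA eB; rewrite eA eB in neq2.
  by rewrite (setIidPl sU) cX ltn_add2l.
rewrite negb_and => notfull.
have lt2p : (#|setX A B| + #|setX A B :&: U| < p + p)%N.
  case/orP: notfull => [ne|nsub]; first lia.
  suff : (#|setX A B :&: U| < #|setX A B|)%N by lia.
  rewrite proper_card // properE subsetIl /=; apply: contra nsub => /subset_trans; apply.
  exact: subsetIr.
have : (N * (#|setX A B| + #|setX A B :&: U|).+1 <= N * (p + p))%N.
  by rewrite leq_mul2l lt2p orbT.
by rewrite mulnS /N; lia.
Qed.

(** With [a = s - d] and [b = s + d], the deficit [s * s - a * b] is [d * d]. *)
Lemma muln_le_even a b s : (a + b = 2 * s)%N ->
  (a * b <= s * s)%N /\ ((a * b = s * s)%N -> a = s /\ b = s).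
Proof.
wlog le_ab : a b / (a <= b)%N => [hw|].
  have [/hw//|/ltnW/hw h] := leqP a b.
  rewrite [(a + b)%N]addnC [(a * b)%N]mulnC => /h[-> h'].
  by split=> // eq_ab; have [] := h' eq_ab.
move=> ab; pose d := (s - a)%N.
have -> : b = (a + 2 * d)%N by rewrite /d; lia.
have -> : s = (a + d)%N by rewrite /d; lia.
split=> [|eq_ab]; first nia.
have : (d * d = 0)%N by nia.
by case: (d) => // _; lia.
Qed.

(** For [a <= b], put [a = s - d] and [b = s + d + 1]: the deficit is [d * d + d]. Undoing the
    symmetry yields the other split. *)
Lemma muln_le_odd a b s : (a + b = 2 * s + 1)%N ->
  (a * b <= s.+1 * s)%N /\
  ((a * b = s.+1 * s)%N -> a = s.+1 /\ b = s \/ a = s /\ b = s.+1).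
Proof.
wlog le_ab : a b / (a <= b)%N => [hw|].
  have [/hw//|/ltnW/hw h] := leqP a b.
  rewrite [(a + b)%N]addnC [(a * b)%N]mulnC => /h[-> h'].
  by split=> // eq_ab; case: (h' eq_ab) => -[-> ->]; [right|left].
move=> ab; pose d := (s - a)%N.
have -> : b = (a + 2 * d + 1)%N by rewrite /d; lia.
have -> : s = (a + d)%N by rewrite /d; lia.
split=> [|eq_ab]; first nia.
have : (d * d + d = 0)%N by nia.
by case: (d) => // _; right; lia.
Qed.

Lemma card_setI_lt S T : #|S| = #|T| -> S != T -> (#|S :&: T| < #|S|)%N.
Proof.
move=> cST; apply: contraNltn => leSI.
have sST : S \subset T by apply/setIidPl/eqP; rewrite eqEcard finset.subsetIl.
by rewrite eqEcard sST cST leqnn.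
Qed.

Lemma even_separates s S T : #|S| = s -> #|T| = s -> S != T ->
  exists c, separates (2 * s) c (biclique_vec R S S) (biclique_vec R T T).
Proof.
move=> cS cT neST; have ltI := card_setI_lt (etrans cS (esym cT)) neST.
(* No ties need breaking, so [G] is empty and [q = 0]. *)
apply: (@separates_biclique _ (setX S S :|: setX T T) finset.set0 (s * s) 0).
- exact: finset.subsetUl.
- exact: finset.subsetUr.
- by rewrite cardsX cS.
- by rewrite cardsX cT.
- by rewrite finset.setI0 cards0.
- by rewrite finset.setI0 cards0.
- by move=> A B /muln_le_even[].
move=> A B /muln_le_even[_ h] /h[cA cB].
have s_gt0 : (0 < s)%N by lia.
have tight (Y Z : {set 'I_n}) : #|Y| = s -> #|Z| = s -> Y \subset Z -> Y = Z.
  by move=> cY cZ sYZ; apply/eqP; rewrite eqEcard sYZ cY cZ leqnn.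
case/subset_rectangles; rewrite ?cA ?cB // => -[sA sB].
- by apply: Or31; split; apply: tight.
- by apply: Or32; split; apply: tight.
(* In both mixed cases a set of size [s] would fit into [S :&: T], which is smaller. *)
- by have := subset_leq_card sA; lia.
- by have := subset_leq_card sB; lia.
Qed.

Lemma odd_separates s (v : 'I_n) S T :
    v \notin S -> v \notin T -> #|S| = s -> #|T| = s -> S != T ->
  exists c, separates (2 * s + 1) c
    (biclique_vec R (v |: S) S) (biclique_vec R (v |: T) T).
Proof.
move=> vS vT cS cT neST; have ltI := card_setI_lt (etrans cS (esym cT)) neST.
have rowG A B : setX A B :&: setX [set~ v] [set: 'I_n] = setX (A :\ v) B.
  by apply/setP => -[i j]; rewrite !inE andbT andbAC [_ && (i != v)]andbC.
(* Rewarding the cells off row [v] amounts to lowering the cost on that row; both target bicliques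
   have [s * s] such cells. *)
apply: (@separates_biclique _ (setX (v |: S) S :|: setX (v |: T) T)
          (setX [set~ v] [set: 'I_n]) (s.+1 * s) (s * s)).
- exact: finset.subsetUl.
- exact: finset.subsetUr.
- by rewrite cardsX cardsU1 vS cS.
- by rewrite cardsX cardsU1 vT cT.
- by rewrite rowG setU1K // cardsX cS.
- by rewrite rowG setU1K // cardsX cT.
- by move=> A B /muln_le_odd[].
move=> A B /muln_le_odd[_ h] /h sizes.
have s_gt0 : (0 < s)%N by lia.
(* [B \subset Y] rules out the split with [#|B| = s.+1]. *)
have fits (Y : {set 'I_n}) : v \notin Y -> #|Y| = s -> A \subset v |: Y -> B \subset Y ->
    A = v |: Y /\ B = Y.
  move=> vY cY sA sB; have := subset_leq_card sA; have := subset_leq_card sB.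
  rewrite cardsU1 vY cY => leB leA.
  by split; apply/eqP; rewrite eqEcard ?sA ?sB ?cardsU1 ?vY cY; lia.
case/subset_rectangles; [lia|lia|..] => -[sA sB].
- by apply: Or31; apply: fits.
- by apply: Or32; apply: fits.
(* Here [A] must be [v |: (S :&: T)] with [#|S :&: T| = s - 1] and [#|B| = s + 1], leaving
   [s * s - 1] cells off row [v], one too few. *)
- apply: Or33; rewrite rowG cardsX.
  rewrite -finset.setUIr in sA; have := subset_leq_card sA.
  have vI : v \notin S :&: T by rewrite inE (negPf vS).
  rewrite cardsU1 vI => leA.
  have [cA cB] : #|A| = s /\ #|B| = s.+1 by lia.
  have eA : A = v |: (S :&: T).
    by apply/eqP; rewrite eqEcard sA cardsU1 vI; lia.
  have := cA; rewrite eA cardsU1 vI setU1K // => cI.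
  by rewrite cB; nia.
- by have := subset_leq_card sB; lia.
Qed.

Lemma leq_bin_omega_even s : ('C(n, s) <= omega_Kmax R n (2 * s))%N.
Proof.
pose P := [set S : {set 'I_n} | #|S| == s].
have <- : #|P| = 'C(n, s) by rewrite card_draws card_ord.
apply: (@leq_card_omega_Kmax _ _ _ _ _ (fun S => biclique_vec R S S)).
- by move=> S; rewrite inE => /eqP cS; exists S, S; rewrite cS; split=> //; lia.
(* The diagonal of the matrix is the indicator of [S]. *)
- move=> S T _ _ /matrixP eST; apply/setP => i; have := eST i i; rewrite !mxE !andbb.
  by case: (i \in S); case: (i \in T) => // /eqP; rewrite ?[0 == 1]eq_sym oner_eq0.
- by move=> S T; rewrite !inE => /eqP cS /eqP cT; exact: even_separates.
Qed.

Lemma leq_bin_omega_odd s : (0 < n)%N -> ('C(n - 1, s) <= omega_Kmax R n (2 * s + 1))%N.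
Proof.
move=> n_gt0; pose v := Ordinal n_gt0.
pose P := [set S : {set 'I_n} | (S \subset [set~ v]) && (#|S| == s)].
have <- : #|P| = 'C(n - 1, s) by rewrite cards_draws cardsC1 card_ord subn1.
have PE S : S \in P -> v \notin S /\ #|S| = s.
  rewrite inE => /andP[/subsetP sS /eqP cS]; split=> //.
  by apply/negP => /sS; rewrite !inE eqxx.
apply: (@leq_card_omega_Kmax _ _ _ _ _ (fun S => biclique_vec R (v |: S) S)).
- move=> S /PE[vS cS]; exists (v |: S), S; rewrite cardsU1 vS cS; split=> //; lia.
(* Row [v] of the matrix is the indicator of [S]. *)
- move=> S T _ _ /matrixP eST; apply/setP => i; have := eST v i; rewrite !mxE !setU11 /=.
  by case: (i \in S); case: (i \in T) => // /eqP; rewrite ?[0 == 1]eq_sym oner_eq0.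
- by move=> S T /PE[vS cS] /PE[vT cT]; exact: odd_separates.
Qed.

End Combinatorics.

(** * The asymptotic bound and the conclusion *)

(** Induction by absorption: the factor [(m + 1) / (s + 1)] splits off, and it is at most [m / s]
    when [0 < s <= m]. *)
Lemma exp_div_le_bin (R : realFieldType) (m s : nat) :
  (s <= m)%N -> (m%:R / s%:R) ^+ s <= 'C(m, s)%:R :> R.
Proof.
elim: s m => [|s IHs] m; first by rewrite expr0 bin0.
case: m => // m les.
have s1_gt0 : 0 < s.+1%:R :> R by rewrite ltr0n.
have binE : 'C(m.+1, s.+1)%:R = m.+1%:R / s.+1%:R * 'C(m, s)%:R :> R.
  apply: (mulfI (lt0r_neq0 s1_gt0)); rewrite mulrA mulrCA mulfV ?lt0r_neq0 // mulr1.
  by rewrite -!natrM mul_bin_diag.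
rewrite exprS binE ler_wpM2l ?divr_ge0 ?ler0n //.
(* Division by 0 yields 0, so the ratio comparison fails at [s = 0]; there the power is 1. *)
case: s => [|s] in les IHs s1_gt0 binE *; first by rewrite expr0 bin0.
apply: le_trans (IHs m les); apply: lerXn2r; rewrite ?nnegrE ?divr_ge0 ?ler0n //.
rewrite ler_pdivrMr // mulrAC ler_pdivlMr ?ltr0n // -!natrM ler_nat; nia.
Qed.

Theorem theorem5 (R : realType) :
  (forall n k : nat, (1 <= n)%N -> (1 <= k <= 2 * n)%N ->
     (forall s : nat, k = (2 * s)%N -> ('C(n, s) <= omega_Kmax R n k)%N) /\
     (forall s : nat, k = (2 * s + 1)%N -> ('C(n - 1, s) <= omega_Kmax R n k)%N))
  /\
  (exists2 C : R, 0 < C &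
     forall n k : nat, (1 <= n)%N -> (1 <= k <= 2 * n)%N ->
       (forall s : nat, k = (2 * s)%N ->
          C * (n%:R / s%:R) ^+ s <= 'C(n, s)%:R) /\
       (forall s : nat, k = (2 * s + 1)%N ->
          C * ((n - 1)%:R / s%:R) ^+ s <= 'C(n - 1, s)%:R)).
Proof.
split=> [n k n_gt0 /andP[k_gt0 k_le]|].
  by split=> s ->; [exact: leq_bin_omega_even | exact: leq_bin_omega_odd].
exists 1 => // n k n_gt0 /andP[k_gt0 k_le].
(* [k <= 2 * n] gives [s <= n] for even [k] and [s <= n - 1] for odd [k]. *)
by split=> s ks; rewrite mul1r; apply: exp_div_le_bin; lia.
Qed.
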